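(* $\chi^{\mathsf{w}}_{3,3}(n)=\Omega\!\left(\dfrac{\log n}{\log\log n}\right)$ as $n\to\infty$; that is, there are constants $c>0$ and $n_0$ such that for all $n\ge n_0$ there is a $3$-uniform hypergraph on $n$ vertices, linearly embeddable into $\mathbb{R}^3$, with weak chromatic number at least $c\log n/\log\log n$.
   Context: A $k$-uniform hypergraph $H=(V,E)$ consists of a finite set $V$ and $E\subseteq\binom{V}{k}$. A (linear) embedding of $H$ into $\mathbb{R}^d$ is a map $\phi:V(H)\to\mathbb{R}^d$ with $\dim\operatorname{aff}\phi(e)=k-1$ for every edge $e$ and $\operatorname{conv}\phi(e_1)\cap\operatorname{conv}\phi(e_2)=\operatorname{conv}\phi(e_1\cap e_2)$ for all edges $e_1,e_2$. $\mathcal{E}_{d,k}$ is the set of $k$-uniform hypergraphs admitting such an embedding into $\mathbb{R}^d$. A weak $c$-coloring of $H$ is a map $\kappa:V(H)\to\{1,\dots,c\}$ with $|\kappa(e)|>1$ for every edge $e$; $\chi^{\mathsf{w}}(H)$ is the least such $c$. $\chi^{\mathsf{w}}_{d,k}(n)=\max\{\chi^{\mathsf{w}}(H): H\in\mathcal{E}_{d,k},\ |V(H)|=n\}$. *)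

(* Defs.v *)
From mathcomp Require Import all_boot.
From Stdlib Require Import Reals.
Set Implicit Arguments. Unset Strict Implicit. Unset Printing Implicit Defensive.

Definition uniform (n k : nat) (E : {set {set 'I_n}}) : Prop :=
  forall e, e \in E -> #|e| = k.

Definition point (d : nat) := 'I_d -> R.

Definition rsum (n : nat) (f : 'I_n -> R) : R := \big[Rplus/0%R]_(i < n) f i.

Definition in_conv (n d : nat) (phi : 'I_n -> point d) (S : {set 'I_n}) (x : point d) : Prop :=
  exists w : 'I_n -> R,
    (forall i, (0 <= w i)%R) /\ (forall i, i \notin S -> w i = 0%R) /\
    rsum w = 1%R /\ (forall j, x j = rsum (fun i => (w i * phi i j)%R)).

(* phi (S) is affinely independent (for |S| = k this is dim aff phi(S) = k-1). *)
Definition aff_indep (n d : nat) (phi : 'I_n -> point d) (S : {set 'I_n}) : Prop :=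
  forall w : 'I_n -> R,
    (forall i, i \notin S -> w i = 0%R) -> rsum w = 0%R ->
    (forall j, rsum (fun i => (w i * phi i j)%R) = 0%R) ->
    forall i, w i = 0%R.

Definition lin_embedding (n d : nat) (E : {set {set 'I_n}}) (phi : 'I_n -> point d) : Prop :=
  (forall e, e \in E -> aff_indep phi e) /\
  (forall e1 e2, e1 \in E -> e2 \in E -> forall x,
      (in_conv phi e1 x /\ in_conv phi e2 x) <-> in_conv phi (e1 :&: e2) x).

Definition in_Edk (d k n : nat) (E : {set {set 'I_n}}) : Prop :=
  uniform k E /\ exists phi : 'I_n -> point d, lin_embedding E phi.

Definition weak_coloring (n c : nat) (E : {set {set 'I_n}}) (kappa : 'I_n -> 'I_c) : Prop :=
  forall e, e \in E -> 1 < #|kappa @: e|.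

Definition weakly_colorable (n c : nat) (E : {set {set 'I_n}}) : Prop :=
  exists kappa : 'I_n -> 'I_c, weak_coloring E kappa.

(* Main.v *)
(** Let H_c be not weakly c-colorable. With m = c + 2, take vertices
    x_0, ..., x_(m-1) and, for i < j < m, a copy B_ij of H_c, and add all
    triangles x_i x_j v with v in B_ij. In a (c+1)-coloring two x's share a color
    k; either some v in B_ij has color k, giving a monochromatic triangle, or B_ij
    is colored with c colors and contains one by induction. This multiplies the
    number of vertices by at most (c + 2)^3, so c = Omega(log n / log log n).

    All vertices are put on the moment curve, B_ij occupying an interval placed
    before x_i (and B_ij before B_il for j < l). Two triangles meet properly as
    soon as some affine function vanishes on their common vertices, is positive
    on the remaining vertices of one and negative on those of the other; on the
    moment curve this is a cubic polynomial with prescribed signs, which exists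
    when the sign pattern along the curve alternates at most three times. *)

Require Import Defs.
From HB Require Import structures.
From mathcomp Require Import all_boot zify.
From Stdlib Require Import Reals Lra.
(* Reals rebinds [^] on nat; this restores the one of ssrnat. *)
From mathcomp Require Import ssrnat.
Set Implicit Arguments. Unset Strict Implicit. Unset Printing Implicit Defensive.

(** * The recursive construction *)

(* With N vertices per copy, the line consists of m groups; group i holds m
   consecutive slots of length N followed by the apex x_i. Only the slots
   B_ij with i < j receive a copy. *)
Definition block m N i j := i * (m * N).+1 + j * N.
Definition apex m N i := i * (m * N).+1 + m * N.

(* Each join edge is listed in increasing order, since B_ij precedes x_i. *)
Definition join_edge m N i j v := [:: block m N i j + v; apex m N i; apex m N j].

Definition glue m N (F : seq (seq nat)) : seq (seq nat) :=
  flatten [seq [seq map (addn (block m N p.1 p.2)) e | e <- F] ++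
               [seq join_edge m N p.1 p.2 v | v <- iota 0 N]
          | p <- [seq (i, j) | i <- iota 0 m, j <- iota 0 m] & p.1 < p.2].

(** The recursion starts from one vertex without edges, which has no coloring with 0 colors. *)
Fixpoint nvert c := if c is c'.+1 then c'.+2 * (c'.+2 * nvert c').+1 else 1.
Fixpoint edges c := if c is c'.+1 then glue c'.+2 (nvert c') (edges c') else [::].

Lemma mem_glue m N F s :
  s \in glue m N F <->
  exists i j, [/\ i < j, j < m &
    (exists2 e, e \in F & s = map (addn (block m N i j)) e) \/
    (exists2 v, v < N & s = join_edge m N i j v)].
Proof.
split=> [/flatten_mapP[[i j]] | [i [j [ij jm H]]]].
  rewrite mem_filter /= => /andP[ij /allpairsP[[i' j'] /= [_ j'm [_ ej]]]].
  move: j'm; rewrite -ej mem_iota add0n => /andP[_ jm] sF.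
  exists i, j; split=> //; move: sF; rewrite mem_cat => /orP[] /mapP[y yF ->].
    by left; exists y.
  by right; exists y => //; move: yF; rewrite mem_iota.
apply/flatten_mapP; exists (i, j) => /=.
  rewrite mem_filter ij /=; apply/allpairsP; exists (i, j).
  by rewrite /= !mem_iota; split=> //; lia.
rewrite mem_cat; case: H => -[y yF ->]; apply/orP; [left|right]; apply: map_f => //.
by rewrite mem_iota.
Qed.

Lemma block_block m N i j l : j < l -> block m N i j + N <= block m N i l.
Proof. by move=> jl; rewrite /block -addnA leq_add2l -mulSnr leq_mul2r jl orbT. Qed.

Lemma block_apex m N i j : j < m -> block m N i j + N <= apex m N i.
Proof. exact: block_block. Qed.

Lemma apex_block m N i k l : i < k -> apex m N i < block m N k l.
Proof.
move=> ik; rewrite /block /apex -addnS -mulSnr.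
by apply: leq_trans (leq_addr _ _); rewrite leq_mul2r ik orbT.
Qed.

Lemma apex_apex m N i k : i < k -> apex m N i < apex m N k.
Proof. by rewrite /apex ltn_add2r ltn_mul2r => ->. Qed.

Definition triples_below N (F : seq (seq nat)) :=
  forall s, s \in F -> exists a b c, s = [:: a; b; c] /\ a < b < c /\ c < N.

Lemma glue_triples m N F :
  triples_below N F -> triples_below (m * (m * N).+1) (glue m N F).
Proof.
move=> FN s /mem_glue[i [j [ij jm H]]].
have ba := @block_apex m N _ _ jm; have aa := @apex_apex m N _ _ ij.
have top : apex m N j < m * (m * N).+1.
  by rewrite /apex -addnS -mulSnr leq_mul2r jm orbT.
have ab := ba i; case: H => -[y].
  move=> /FN[a [b [c [-> abc]]]] ->; exists (block m N i j + a), (block m N i j + b).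
  by exists (block m N i j + c); split=> //=; lia.
by move=> vN ->; do 3 eexists; split; [reflexivity | lia].
Qed.

Lemma edges_triples c : triples_below (nvert c) (edges c).
Proof. by elim: c => [|c IH] //; apply: glue_triples. Qed.

(** * Separation by sign patterns *)

(* The cubic has roots r1, r2, r3 and vertex t sits at abscissa 2t+1, so an odd
   root is a vertex and an even root lies between two vertices; a root 0 is
   padding, being left of every vertex. *)
Definition negative r1 r2 r3 t :=
  (t.*2.+1 < r1) (+) (t.*2.+1 < r2) (+) (t.*2.+1 < r3).

(** Natural numbers alone occur, so that [lia] settles each instance; [b] tells whether the cubic is
    negative on the vertices of [s1] alone. *)
Definition separated (s1 s2 : seq nat) :=
  exists r1 r2 r3 b, forall t,
    [/\ t \in s1 -> t \in s2 -> t.*2.+1 \in [:: r1; r2; r3],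
        t \in s1 -> t \notin s2 ->
          (t.*2.+1 \notin [:: r1; r2; r3]) && (negative r1 r2 r3 t == b) &
        t \in s2 -> t \notin s1 ->
          (t.*2.+1 \notin [:: r1; r2; r3]) && (negative r1 r2 r3 t == ~~ b)].

Lemma separated_sym s1 s2 : separated s1 s2 -> separated s2 s1.
Proof.
move=> [r1 [r2 [r3 [b H]]]]; exists r1, r2, r3, (~~ b) => t.
by have [H1 H2 H3] := H t; split=> *; [apply: H1 | apply: H3 | rewrite negbK; apply: H2].
Qed.

Lemma separated_shift k s1 s2 :
  separated s1 s2 -> separated (map (addn k) s1) (map (addn k) s2).
Proof.
have inj := @addnI k.
move=> [r1 [r2 [r3 [b H]]]]; exists (k.*2 + r1), (k.*2 + r2), (k.*2 + r3), b => t.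
have E (s : seq nat) : t \in map (addn k) s -> exists2 u, u \in s & t = k + u.
  by move=> /mapP[u us ->]; exists u.
have sh u r : ((k + u).*2.+1 < k.*2 + r) = (u.*2.+1 < r) by lia.
have eq u r : ((k + u).*2.+1 == k.*2 + r) = (u.*2.+1 == r) by lia.
split=> /E[u us ->]; rewrite (mem_map inj) => u2; move: (H u) => [H1 H2 H3];
  rewrite /negative !inE ?sh !eq; [move: (H1 us u2) | move: (H2 us u2) | move: (H3 us u2)];
  by rewrite /negative !inE.
Qed.

(** A root [x.*2] sits just before vertex [x], a root [x.*2.+1] on it. *)
Ltac sep r1 r2 r3 b :=
  exists r1, r2, r3, b => t; rewrite /negative !inE; split; lia.

(** As [x] and [y] lie beyond the copy, only the place of [w] among [a], [b], [c] matters; at worst,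
    as for [a < w < b], the sign changes three times. *)
Lemma separated_copy_join_same E a b c w x y :
  a < b < c -> c < E -> w < E -> E <= x -> x < y ->
  separated [:: a; b; c] [:: w; x; y].
Proof.
move=> abc cE wE Ex xy.
have [wa|aw|->] := ltngtP w a.
- by sep a.*2 E.*2 0 true.
- have [wb|bw|->] := ltngtP w b.
  + by sep w.*2 b.*2 E.*2 true.
  + have [wc|cw|->] := ltngtP w c.
    * by sep w.*2 c.*2 E.*2 true.
    * by sep w.*2 0 0 true.
    * by sep c.*2.+1 0 0 true.
  + by sep b.*2.+1 c.*2 E.*2 true.
- by sep a.*2.+1 E.*2 0 true.
Qed.

Lemma separated_copy_far D E a b c s :
  D <= a -> a < b < c -> c < E -> (forall t, t \in s -> t < D \/ E <= t) ->
  separated [:: a; b; c] s.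
Proof.
move=> Da abc cE far; exists D.*2, E.*2, 0, true => t.
by rewrite /negative !inE; split=> [|? _|/far]; [move=> + /far| |]; lia.
Qed.

Lemma separated_join_common_low v w x y z :
  v < w -> w < x -> x < y -> y < z -> separated [:: v; x; y] [:: w; x; z].
Proof. by move=> *; sep w.*2 x.*2.+1 z.*2 true. Qed.

Lemma separated_joins v x y w x' y' :
  v < x -> x < w -> w < x' -> x' < y' -> x < y -> (y <= x' -> x' != y -> y < w) ->
  separated [:: v; x; y] [:: w; x'; y'].
Proof.
move=> vx xw wx' xy' xy Hy.
have [yx'|x'y|e] := ltngtP y x'.
- have {Hy} Hy : y < w by lia.
  by sep w.*2 0 0 true.
- have [yy'|y'y|e] := ltngtP y y'.
  + by sep w.*2 y.*2 y'.*2 true.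
  + by sep w.*2 y.*2 0 false.
  + by subst y'; sep w.*2 y.*2.+1 y.*2.+1 true.
(* The double root vanishes at the shared apex and leaves [w] and [y'] on the same side. *)
- by subst x'; sep w.*2 y.*2.+1 y.*2.+1 true.
Qed.

Definition pairwise_separated (F : seq (seq nat)) :=
  forall s1 s2, s1 \in F -> s2 \in F -> separated s1 s2.

(** Slots follow the lexicographic order of their index pairs, so [B_ij] ends before [B_kl] starts;
    only the place of the apexes varies. *)
Lemma separated_glue_lex m N F i j k l s1 s2 :
  triples_below N F ->
  i < k \/ i = k /\ j < l -> i < j -> j < m -> k < l -> l < m ->
  (exists2 e, e \in F & s1 = map (addn (block m N i j)) e) \/
    (exists2 v, v < N & s1 = join_edge m N i j v) ->
  (exists2 e, e \in F & s2 = map (addn (block m N k l)) e) \/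
    (exists2 v, v < N & s2 = join_edge m N k l v) ->
  separated s1 s2.
Proof.
move=> FN lex ij jm kl lm H1 H2.
have bij := @block_apex m N i j jm; have bkl := @block_apex m N k l lm.
have aij := @apex_apex m N _ _ ij; have akl := @apex_apex m N _ _ kl.
have bb : block m N i j + N <= block m N k l.
  case: lex => [ik|[-> jl]]; last exact: block_block.
  by have := @apex_block m N i k l ik; lia.
have ord : apex m N i < block m N k l \/ i = k.
  by case: lex => [ik|[-> _]]; [left; apply: apex_block | right].
have aj : apex m N j < block m N k l \/ apex m N k <= apex m N j.
  case: (ltnP j k) => [jk|kj]; first by left; apply: apex_block.
  by right; rewrite leq_add2r leq_mul2r kj orbT.
case: H1 => -[u uF ->]; case: H2 => -[w wF ->].
- move: uF wF => /FN[a [b [c [-> [abc cN]]]]] /FN[a' [b' [c' [-> [abc' cN']]]]] /=.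
  by sep (block m N k l).*2 0 0 true.
- move: uF => /FN[a [b [c [-> [abc cN]]]]] /=.
  apply: (@separated_copy_far (block m N i j) (block m N i j + N)); try lia.
  by move=> t; rewrite !inE; lia.
- move: wF => /FN[a [b [c [-> [abc cN]]]]] /=; apply: separated_sym.
  apply: (@separated_copy_far (block m N k l) (block m N k l + N)); try lia.
  move=> t; rewrite !inE => /or3P[] /eqP->; [lia | | lia].
  by case: ord => [|e]; [lia | subst k; lia].
- case: lex => [ik|[e jl]].
    have aik := @apex_block m N i k l ik.
    by apply: separated_joins; lia.
  subst k; apply: separated_join_common_low; try lia.
  exact: apex_apex.
Qed.

Lemma glue_separated m N F :
  triples_below N F -> pairwise_separated F -> pairwise_separated (glue m N F).
Proof.
move=> FN FS s1 s2 /mem_glue[i [j [ij jm H1]]] /mem_glue[k [l [kl lm H2]]].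
have [lt|gt|eik] := ltngtP i k.
- by apply: (separated_glue_lex FN _ ij jm kl lm H1 H2); left.
- by apply/separated_sym/(separated_glue_lex FN _ kl lm ij jm H2 H1); left.
have [lt|gt|ejl] := ltngtP j l.
- by apply: (separated_glue_lex FN _ ij jm kl lm H1 H2); right.
- by apply/separated_sym/(separated_glue_lex FN _ kl lm ij jm H2 H1); right.
subst k l; have bij := @block_apex m N i j jm; have aij := @apex_apex m N _ _ ij.
case: H1 => -[u uF ->]; case: H2 => -[w wF ->].
- exact/separated_shift/FS.
- move: uF => /FN[a [b [c [-> [abc cN]]]]] /=.
  by apply: (@separated_copy_join_same (block m N i j + N)); lia.
- move: wF => /FN[a [b [c [-> [abc cN]]]]] /=; apply: separated_sym.
  by apply: (@separated_copy_join_same (block m N i j + N)); lia.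
(* Both apexes are common and take two roots; the third separates [u] from [w], or sits on them if
   they coincide. *)
rewrite /join_edge.
have [uw|wu|->] := ltngtP u w.
- by sep (block m N i j + w).*2 (apex m N i).*2.+1 (apex m N j).*2.+1 true.
- by sep (block m N i j + u).*2 (apex m N i).*2.+1 (apex m N j).*2.+1 false.
- by sep (block m N i j + w).*2.+1 (apex m N i).*2.+1 (apex m N j).*2.+1 true.
Qed.

Lemma edges_separated c : pairwise_separated (edges c).
Proof. by elim: c => [|c IH] //; apply: glue_separated => //; apply: edges_triples. Qed.

(** * Failure of colorings with few colors *)

(** The palette is an arbitrary list, so that the induction can delete a color from it. *)
Lemma edges_monochromatic (T : eqType) c (A : seq T) (kappa : nat -> T) :
  size A <= c -> (forall v, v < nvert c -> kappa v \in A) ->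
  exists s k, s \in edges c /\ forall t, t \in s -> kappa t = k.
Proof.
elim: c A kappa => [|c IH] A kappa sA Ak.
  by move: sA; rewrite leqn0 => /nilP A0; have := Ak 0 isT; rewrite A0.
pose m := c.+2; pose N := nvert c; pose x := apex m N.
have x_top i : i < m -> x i < nvert c.+1.
  by move=> im; rewrite /x /apex -addnS -mulSnr leq_mul2r im orbT.
(* Pigeonhole: [c.+2] apexes, at most [c.+1] colors. *)
have /uniqPn : ~~ uniq [seq kappa (x i) | i <- iota 0 m].
  apply/negP => /uniq_leq_size/(_ _)-/(_ A) H.
  suff : m <= size A by rewrite /m; lia.
  rewrite -[m](size_iota 0) -(size_map (kappa \o x)); apply: H => k /mapP[i].
  by rewrite mem_iota => /andP[_ im] ->; apply/Ak/x_top.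
case/(_ (kappa 0)) => i [j [ij]]; rewrite size_map size_iota => jm.
have im := ltn_trans ij jm.
rewrite !(nth_map 0) ?size_iota // !nth_iota // !add0n => eqx.
have inblock v : v < N -> block m N i j + v < nvert c.+1.
  move=> vN; apply: (ltn_trans _ (x_top i im)).
  by have := @block_apex m N i j jm; rewrite /x; lia.
case: (boolP [exists v : 'I_N, kappa (block m N i j + v) == kappa (x i)]).
  move=> /existsP[v /eqP ev]; exists (join_edge m N i j v), (kappa (x i)); split.
    apply/mem_glue; exists i, j; split=> //; right.
    by exists v; first exact: (ltn_ord v).
  by move=> t; rewrite !inE => /or3P[] /eqP-> //; exact: esym eqx.
move=> /existsPn nv.
have [||s [k [sE sk]]] := IH (filter (predC1 (kappa (x i))) A)
    (fun v => kappa (block m N i j + v)).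
- rewrite -ltnS; apply: leq_trans sA; rewrite size_filter.
  rewrite -(count_predC (predC1 (kappa (x i)))) -[X in X < _]addn0 ltn_add2l.
  rewrite -has_count; apply/hasP; exists (kappa (x i)); last by rewrite /= negbK.
  exact/Ak/x_top.
- by move=> v vN; rewrite mem_filter /= (nv (Ordinal vN)) /=; apply/Ak/inblock.
exists (map (addn (block m N i j)) s), k; split.
  by apply/mem_glue; exists i, j; split=> //; left; exists s.
by move=> t /mapP[v vs ->]; apply: sk.
Qed.

(** * Vertex count *)

Lemma nvert_gt0 c : 0 < nvert c.
Proof. by case: c => [|c] //=; rewrite mulSn addSn. Qed.

Lemma nvert_le c : nvert c <= c.+1 ^ (3 * c).
Proof.
elim: c => [|c IH] //; rewrite (mulnS 3 c) expnD /=.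
apply: (@leq_trans (c.+2 ^ 3 * nvert c)).
  rewrite !expnS expn0 muln1 -!mulnA leq_mul2l /=.
  (* Positivity of the count absorbs the successor. *)
  by have : 0 < c.+2 * nvert c; [rewrite muln_gt0 nvert_gt0 | nia].
by rewrite leq_mul2l (leq_trans IH) ?orbT //; case: (c) => // d; rewrite leq_exp2r.
Qed.

(** * Real sums and the moment curve *)

HB.instance Definition _ :=
  Monoid.isComLaw.Build R 0%R Rplus (fun x y z => esym (Rplus_assoc x y z))
    Rplus_comm Rplus_0_l.

Lemma rsumD n (f g : 'I_n -> R) :
  rsum (fun i => f i + g i)%R = (rsum f + rsum g)%R.
Proof. exact: big_split. Qed.

Lemma rsumZ n a (f : 'I_n -> R) : rsum (fun i => a * f i)%R = (a * rsum f)%R.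
Proof. by rewrite /rsum (big_morph _ (Rmult_plus_distr_l a) (Rmult_0_r a)). Qed.

Lemma eq_rsum n (f g : 'I_n -> R) : f =1 g -> rsum f = rsum g.
Proof. by move=> fg; apply: eq_bigr => i _. Qed.

Lemma rsum_eq0 n (f : 'I_n -> R) :
  (forall i, 0 <= f i)%R -> rsum f = 0%R -> forall i, f i = 0%R.
Proof.
move=> f0 + i; rewrite /rsum (bigD1 i) //=; set S := bigop.body _ _ _ => sf.
have S0 : (0 <= S)%R by apply: big_ind => [|x y *|j _]; [lra | lra | exact: f0].
by have := f0 i; lra.
Qed.

Definition abscissa (t : nat) : R := INR t.*2.+1.

Definition moment (t : nat) : point 3 := fun j => (abscissa t ^ j.+1)%R.

Definition cubic r1 r2 r3 (x : R) : R := ((x - INR r1) * (x - INR r2) * (x - INR r3))%R.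

(** Such weights annihilate the monomials of degree 0 to 3, hence every cubic. *)
Lemma rsum_cubic n (w : 'I_n -> R) r1 r2 r3 :
  rsum w = 0%R -> (forall j, rsum (fun i => w i * moment i j)%R = 0%R) ->
  rsum (fun i => w i * cubic r1 r2 r3 (abscissa i))%R = 0%R.
Proof.
move=> w0 wm; have := wm (@Ordinal 3 0 isT); have := wm (@Ordinal 3 1 isT).
have := wm (@Ordinal 3 2 isT) => {wm}; rewrite /moment /= => w3 w2 w1.
pose a := INR r1; pose b := INR r2; pose c := INR r3.
rewrite (_ : rsum _ = rsum (fun i => w i * (abscissa i * (abscissa i * (abscissa i * 1)))
  + (- (a + b + c) * (w i * (abscissa i * (abscissa i * 1)))
  + ((a * b + b * c + c * a) * (w i * (abscissa i * 1)) + - (a * b * c) * w i)))%R).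
  by rewrite !rsumD !rsumZ w0 w1 w2 w3; ring.
by apply: eq_rsum => i; rewrite /cubic -/a -/b -/c; ring.
Qed.

Definition has_sign (b : bool) (x : R) := if b then (x < 0)%R else (0 < x)%R.

Lemma has_signM b b' x y :
  has_sign b x -> has_sign b' y -> has_sign (b (+) b') (x * y)%R.
Proof. by case: b; case: b' => /=; nra. Qed.

Lemma cubic_has_sign r1 r2 r3 t :
  t.*2.+1 \notin [:: r1; r2; r3] ->
  has_sign (negative r1 r2 r3 t) (cubic r1 r2 r3 (abscissa t)).
Proof.
have fac r : t.*2.+1 != r -> has_sign (t.*2.+1 < r) (abscissa t - INR r)%R.
  rewrite /abscissa; have [/ltP/lt_INR|/ltP/lt_INR|] := ltngtP _ r => //=; lra.
rewrite !inE !negb_or => /and3P[/fac h1 /fac h2 /fac h3].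
by apply: has_signM => //; apply: has_signM.
Qed.

Lemma cubic_root r1 r2 r3 t :
  t.*2.+1 \in [:: r1; r2; r3] -> cubic r1 r2 r3 (abscissa t) = 0%R.
Proof. by rewrite !inE /cubic => /or3P[] /eqP<-; rewrite -/(abscissa t); ring. Qed.

Definition vset n (s : seq nat) : {set 'I_n} := [set i : 'I_n | val i \in s].

(** Two representations of [x] differ by weights [u] that annihilate the cubic [f]. Up to the global
    sign [sg], each [u i * f i] is nonnegative, so all vanish; as [f] is nonzero on [s1] outside
    [s2], [w] is supported on the common vertices. *)
Lemma separated_in_conv n s1 s2 (x : point 3) :
  separated s1 s2 ->
  in_conv (fun i : 'I_n => moment i) (vset n s1) x ->
  in_conv (fun i : 'I_n => moment i) (vset n s2) x ->
  in_conv (fun i : 'I_n => moment i) (vset n s1 :&: vset n s2) x.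
Proof.
move=> [r1 [r2 [r3 [b sep]]]] [w [w_ge0 [w_supp [w_sum wx]]]] [v [v_ge0 [v_supp [v_sum vx]]]].
pose f i := cubic r1 r2 r3 (abscissa i); pose sg := if b then (-1)%R else 1%R.
pose u i := (w i + -1 * v i)%R.
have u_f : rsum (fun i => u i * f i)%R = 0%R.
  apply: rsum_cubic => [|j]; rewrite /u ?rsumD ?rsumZ ?w_sum ?v_sum; first by ring.
  rewrite (eq_rsum (g := fun i => (w i * moment i j + -1 * (v i * moment i j))%R)).
    by rewrite rsumD rsumZ -wx -vx; ring.
  by move=> i /=; ring.
have u_term i : (0 <= sg * (u i * f i))%R /\ (i \notin vset n s2 -> w i * f i = 0 -> w i = 0)%R.
  have [H1 H2 H3] := sep (val i); rewrite inE /u /sg.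
  have [is1|is1] := boolP (val i \in s1); have [is2|is2] := boolP (val i \in s2).
  - by rewrite /f cubic_root ?H1 //; split=> //; lra.
  - have v0 : v i = 0%R by apply: v_supp; rewrite inE.
    have /andP[/cubic_has_sign + /eqP nb] := H2 is1 is2; rewrite nb -/(f i) v0.
    have := w_ge0 i; case: (b) => /= w0 fi; split=> [|_ wf]; try nra.
  - have w0 : w i = 0%R by apply: w_supp; rewrite inE.
    have /andP[/cubic_has_sign + /eqP nb] := H3 is2 is1; rewrite nb -/(f i) w0.
    by have := v_ge0 i; case: (b) => /= v0 fi; split=> [|_ wf]; nra.
  - have w0 : w i = 0%R by apply: w_supp; rewrite inE.
    have v0 : v i = 0%R by apply: v_supp; rewrite inE.
    by rewrite w0 v0; split=> //; lra.
exists w; split=> //; split=> // i; rewrite inE negb_and => /orP[/w_supp //|is2].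
have sg_sum : rsum (fun i => sg * (u i * f i))%R = 0%R by rewrite rsumZ u_f; ring.
have := rsum_eq0 (fun i => (u_term i).1) sg_sum i.
rewrite /u (v_supp i is2) => ui; apply: (u_term i).2 => //.
by move: ui; rewrite /sg; case: (b); lra.
Qed.

Lemma in_conv_sub n d (phi : 'I_n -> point d) (S T : {set 'I_n}) x :
  S \subset T -> in_conv phi S x -> in_conv phi T x.
Proof.
move=> /subsetP ST [w [w0 [wS H]]]; exists w; split=> //; split=> // i iT.
by apply: wS; apply: contra iT => /ST.
Qed.

(** The cubic with roots at the other two vertices and at 0 isolates the weight of a vertex;
    abscissae are odd, so 0 is none of them. *)
Lemma aff_indep_moment n a b c :
  a < b < c -> aff_indep (fun i : 'I_n => moment i) (vset n [:: a; b; c]).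
Proof.
move=> abc w w_supp w_sum w_mom i.
have [|/w_supp //] := boolP (i \in vset n [:: a; b; c]).
suff kill (p q : nat) : p != i -> q != i -> (forall j : 'I_n, j != i ->
    j \in vset n [:: a; b; c] -> (val j \in [:: p; q])) -> w i = 0%R.
  rewrite inE !inE => /or3P[] /eqP ei;
    [apply: (kill b c) | apply: (kill a c) | apply: (kill a b)];
    try (move: ei; rewrite /=; lia); move=> j; rewrite -val_eqE /= !inE; move: ei => /=; lia.
move=> pi qi pq; have := rsum_cubic p.*2.+1 q.*2.+1 0 w_sum w_mom.
rewrite /rsum (bigD1 i) //= big1 => [|j ji].
  have : i.*2.+1 \notin [:: p.*2.+1; q.*2.+1; 0] by rewrite !inE; lia.
  move=> /cubic_has_sign; case: negative => /=; nra.
have [/(pq _ ji) jpq|/w_supp ->] := boolP (j \in vset n [:: a; b; c]); last by ring.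
by rewrite cubic_root ?Rmult_0_r //; move: jpq; rewrite !inE /=; lia.
Qed.

(** * The hypergraph on [n] vertices and the final bound *)

Definition hyperedges n c : {set {set 'I_n}} := [set e in [seq vset n s | s <- edges c]].

Lemma hyperedges_in_Edk n c : nvert c <= n -> in_Edk 3 3 (hyperedges n c).
Proof.
move=> cn; split=> [e|].
  rewrite inE => /mapP[s /edges_triples[i [j [k [-> [ijk kN]]]]] ->].
  have lt t : t <= k -> t < n by lia.
  have li : i < n by lia. have lj : j < n by lia. have lk : k < n by lia.
  rewrite (_ : vset _ _ = Ordinal li |: (Ordinal lj |: [set Ordinal lk])).
    by rewrite !cardsU1 cards1 !inE -!val_eqE /=; lia.
  by apply/setP => t; rewrite !inE -!val_eqE.
exists (fun i => moment i); split=> [e|e1 e2].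
  rewrite inE => /mapP[s /edges_triples[i [j [k [-> [ijk kN]]]]] ->].
  exact: aff_indep_moment.
rewrite !inE => /mapP[s1 sE1 ->] /mapP[s2 sE2 ->] x; split=> [[]|H].
  exact/separated_in_conv/(edges_separated sE1 sE2).
by split; apply: in_conv_sub H; rewrite ?subsetIl ?subsetIr.
Qed.

Lemma hyperedges_not_colorable n c c' :
  nvert c <= n -> weakly_colorable c' (hyperedges n c) -> c < c'.
Proof.
move=> cn [kappa col]; rewrite ltnNge; apply/negP => c'c.
(* A nonempty vertex type lets [inord] extend the coloring to all naturals. *)
case: n cn kappa col => [|n] cn kappa col; first by have := nvert_gt0 c; lia.
have [||s [k [sE sk]]] := @edges_monochromatic _ c (enum 'I_c') (fun t => kappa (inord t)).
- by rewrite size_enum_ord.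
- by move=> v _; rewrite mem_enum.
suff : 1 < #|[set k]| by rewrite cards1.
apply: leq_trans (col (vset n.+1 s) _) _; first by rewrite inE map_f.
apply/subset_leq_card/subsetP => _ /imsetP[i + ->]; rewrite !inE => /sk.
by rewrite inord_val => ->.
Qed.

(** The largest [c] with [c.+1 ^ (3 * c) <= n] works, by maximality. *)
Lemma exists_level n : 0 < n -> exists c, nvert c <= n /\ n < c.+2 ^ (3 * c.+1).
Proof.
move=> n0; have ex0 : exists c, c.+1 ^ (3 * c) <= n by exists 0.
have bnd c : c.+1 ^ (3 * c) <= n -> c <= n.
  case: c => // c H; apply/ltnW/(leq_trans _ H)/(leq_trans (ltn_expl c.+1 (ltnSn 1))).
  by apply: (@leq_trans (2 ^ (3 * c.+1))); rewrite ?leq_exp2r ?leq_exp2l //; lia.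
case: (ex_maxnP ex0 bnd) => c cn cmax; exists c.
split; first exact: leq_trans (nvert_le c) cn.
by rewrite ltnNge; apply/negP => /cmax; rewrite ltnn.
Qed.

Lemma INR_expn a b : INR (a ^ b) = (INR a ^ b)%R.
Proof. by elim: b => [|b IH] //=; rewrite expnS mult_INR IH. Qed.

Lemma ln_le x y : (0 < x -> x <= y -> ln x <= ln y)%R.
Proof.
by move=> x0 [xy|->]; [apply/Rlt_le/ln_increasing | apply: Rle_refl].
Qed.

(* chi^w_{3,3}(n) = Omega(log n / log log n): some H in E_{3,3} on n vertices
   has chi^w(H) >= c log n / log log n, i.e. every weak c'-coloring has
   c' >= c log n / log log n. *)
Theorem mainTheorem16 :
  exists (c : R) (n0 : nat), (0 < c)%R /\
    forall n : nat, (n0 <= n)%N ->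
      exists E : {set {set 'I_n}}, in_Edk 3 3 E /\
        forall c' : nat, weakly_colorable c' E ->
          (c * ln (INR n) / ln (ln (INR n)) <= INR c')%R.
Proof.
(* Since e is at most 3, 27 ensures [3 <= L] and [1 <= ln L]. The 6 is the 3 of the exponent times
   the 2 of [ln (k + 1) <= 2 * ln L], which holds when [k < L]. *)
exists (/ 6)%R, 27; split=> [|n n27]; first lra.
have [c [cn nc]] := exists_level (ltn_trans (isT : 0 < 26) n27).
exists (hyperedges n c); split=> [|c' /(hyperedges_not_colorable cn) cc'].
  exact: hyperedges_in_Edk.
set L := ln (INR n); pose k := INR c'.
have exp3 : (exp 3 <= 27)%R.
  have -> : (3 = 1 + (1 + 1))%R by ring.
  rewrite !exp_plus; have := exp_le_3; have := exp_pos 1; nra.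
have n27R : (27 <= INR n)%R by have /leP/le_INR := n27; rewrite /=; lra.
have L3 : (3 <= L)%R by rewrite -(ln_exp 3); apply: ln_le; [exact: exp_pos | lra].
have lnL : (1 <= ln L)%R.
  rewrite -(ln_exp 1); apply: ln_le; first exact: exp_pos.
  by have := exp_le_3; lra.
have k1 : (1 <= k)%R by apply: (le_INR 1); apply/leP; lia.
have Lk : (L <= 3 * k * ln (k + 1))%R.
  have nk : n <= c'.+1 ^ (3 * c').
    apply: (leq_trans (ltnW nc)); apply: (@leq_trans (c'.+1 ^ (3 * c.+1))).
      by rewrite leq_exp2r //; lia.
    by rewrite leq_exp2l; lia.
  rewrite (_ : 3 * k * _ = ln (INR (c'.+1 ^ (3 * c'))))%R.
    by apply: ln_le; [lra | apply/le_INR/leP].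
  rewrite INR_expn ln_pow; last by apply/lt_0_INR/ltP.
  by rewrite mult_INR (S_INR c') (_ : INR 3 = 3%R) /k; [ring | rewrite /=; lra].
rewrite -/k; apply: (Rmult_le_reg_r (6 * ln L)); first lra.
rewrite (_ : / 6 * L / ln L * (6 * ln L) = L)%R; last by field; lra.
have [Lk'|kL] := Rle_lt_dec L k; first by nra.
have : (ln (k + 1) <= 2 * ln L)%R.
  have -> : (2 * ln L = ln (L * L))%R by rewrite ln_mult; lra.
  by apply: ln_le; nra.
nra.
Qed.
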